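(* (i) For every real $\gamma$ with $0<\gamma\le 1$, the function $$C_\gamma(s,t)=(s+t)^\gamma-(\max(s,t))^\gamma,\qquad s,t\ge 0,$$ is nonnegative definite on $[0,\infty)$. (ii) Let $\gamma>0$ be real. The function $$Q_\gamma(s,t)=(\max(s,t))^\gamma-|t-s|^\gamma,\qquad s,t\ge 0,$$ is nonnegative definite on $[0,\infty)$ if and only if $\gamma\le 1$. (iii) Let $H>0$ and $0<K\le 1$ be real numbers such that $2HK\le 1$, and let $$R_{H,K}(t,s)=\frac{1}{2^K}\left(\left(t^{2H}+s^{2H}\right)^K-|t-s|^{2HK}\right),\qquad s,t\ge 0.$$ Then $R_{H,K}$ is nonnegative definite on $[0,\infty)$. Moreover, for all $s,t\ge 0$, $$R_{H,K}(s,t)=2^{-K}C_K(s^{2H},t^{2H})+2^{-K}Q_{2HK}(s,t),$$ where $C_K$ and $Q_{2HK}$ are the functions defined in (i) and (ii) with $\gamma=K$ and $\gamma=2HK$, respectively.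
   Context: A function $F:[0,\infty)\times[0,\infty)\to\mathbb{R}$ is called nonnegative definite if it is symmetric and for every $n\in\mathbb{N}$, all $t_1,\ldots,t_n\ge 0$ and all $z_1,\ldots,z_n\in\mathbb{C}$ one has $\sum_{j,k=1}^n z_j F(t_j,t_k)\overline{z_k}\ge 0$. *)

(* Defs.v *)
From mathcomp Require Import all_boot all_order all_algebra.
From mathcomp Require Import complex.
From mathcomp Require Import reals exp.

Set Implicit Arguments.
Unset Strict Implicit.
Unset Printing Implicit Defensive.

Import Order.TTheory GRing.Theory Num.Theory.
Local Open Scope ring_scope.

(* Kernels on [0, oo) x [0, oo) are total functions of which only the values at
   nonnegative arguments matter.  On [R[i]], [0 <= w] means that [w] is real and
   nonnegative. *)
Definition nonneg_definite (R : realType) (F : R -> R -> R) : Prop :=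
  (forall s t : R, 0 <= s -> 0 <= t -> F s t = F t s) /\
  (forall (n : nat) (t : 'I_n -> R) (z : 'I_n -> R[i]),
     (forall j, 0 <= t j) ->
     0 <= \sum_(j < n) \sum_(k < n) z j * (F (t j) (t k))%:C%C * ((z k)^*)%C).

(* [0 `^ g = 0] for [g != 0], as required for the powers below. *)
Definition Ckernel (R : realType) (g : R) (s t : R) : R :=
  (s + t) `^ g - (Num.max s t) `^ g.

Definition Qkernel (R : realType) (g : R) (s t : R) : R :=
  (Num.max s t) `^ g - `|t - s| `^ g.

Definition Rkernel (R : realType) (H K : R) (t s : R) : R :=
  1 / 2 `^ K * ((t `^ (2 * H) + s `^ (2 * H)) `^ K - `|t - s| `^ (2 * H * K)).

(* Main.v *)
Require Import Defs.
From mathcomp Require Import all_boot all_order all_algebra.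
From mathcomp Require Import complex.
From mathcomp Require Import reals exp.
From mathcomp Require Import ring lra.
From mathcomp Require Import classical_sets interval_inference convex hoelder.

Import Order.TTheory GRing.Theory Num.Theory.
Local Open Scope ring_scope.

(** Read [F] as the covariance of a process [X] started at 0.  The double
    difference of [F] over two intervals is then the covariance of the two
    increments of [X].  If disjoint intervals have nonpositively correlated
    increments, and every increment before a time [c] has nonnegative covariance
    with [X_c], then the covariance matrix of the successive increments along
    any grid has nonpositive off-diagonal entries and nonnegative row sums: it
    is diagonally dominant, hence nonnegative definite, and so is [F], whose
    values are sums of entries of that matrix.  This criterion is
    [nonneg_definite_neg_increments].

    Both kernels of the theorem satisfy it because [x `^ g] is nondecreasing
    and concave when [0 < g <= 1].  Over disjoint intervals the terms in
    [Num.max s t] cancel, as they depend only on the later time; what is left of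
    [Ckernel] is a second difference of [x `^ g], and what is left of [Qkernel]
    is also a second difference of [x `^ g], taken between the gaps of the two
    intervals.  Concavity says that these are nonpositive.

    When [1 < g] the kernel [Qkernel g] violates the Cauchy-Schwarz inequality
    at the times [1 - e] and 1 for small [e]: the squared covariance
    [(1 - e `^ g) ^+ 2] is [1 - o(e)] while the product of the variances,
    [(1 - e) `^ g], is at most [1 - e].

    Finally, [Rkernel H K] is a nonnegative combination of [Qkernel (2 * H * K)]
    and of [Ckernel K] after the change of time [t `^ (2 * H)]. *)

(** * Concavity of the powers *)

(** The inverse function [x `^ g^-1] is convex, because [1 <= g^-1], and the
    inverse of an increasing convex function is concave. *)
Lemma powR_concave (R : realType) (g l u v : R) :
  0 < g -> g <= 1 -> 0 <= l -> l <= 1 -> 0 <= u -> 0 <= v ->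
  l * u `^ g + (1 - l) * v `^ g <= (l * u + (1 - l) * v) `^ g.
Proof.
move=> g0 g1 l0 l1 u0 v0.
have gK (x : R) : 0 <= x -> (x `^ g) `^ g^-1 = x.
  by move=> x0; rewrite -powRrM divff ?gt_eqF// powRr1.
have m0 : 0 <= l * u `^ g + (1 - l) * v `^ g.
  by rewrite addr_ge0// mulr_ge0 ?powR_ge0 ?subr_ge0.
have := @convex_powR R g^-1 _ (Itv01 l0 l1) (u `^ g) (v `^ g).
rewrite invf_ge1// => /(_ g1).
rewrite !inE /= !in_itv /= !powR_ge0 => /(_ isT isT).
rewrite /conv /= !gK// => le.
have := @ge0_ler_powR R g (ltW g0) _ _ _ _ le.
rewrite -powRrM mulVf ?gt_eqF// powRr1//.
by apply; rewrite nnegrE ?powR_ge0// addr_ge0// mulr_ge0 ?subr_ge0.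
Qed.

(** The four points satisfy [a <= a + h, b <= b + h], and the two inner ones are
    symmetric convex combinations of the outer ones: adding the two concavity
    inequalities makes the weights sum to 1. *)
Lemma powR_increment_nonincreasing (R : realType) (g a b h : R) :
  0 < g -> g <= 1 -> 0 <= a -> a <= b -> 0 <= h ->
  (b + h) `^ g - b `^ g <= (a + h) `^ g - a `^ g.
Proof.
move=> g0 g1 a0 ab h0.
have [-> //|ab'] := eqVneq a b.
have d0 : 0 < b + h - a by move: ab'; rewrite neq_lt; lra.
(* [l] is the weight for which [b = l * a + (1 - l) * (b + h)]. *)
pose l := h / (b + h - a).
have l0 : 0 <= l by rewrite divr_ge0// ltW.
have l1 : l <= 1 by rewrite ler_pdivrMr//; lra.
have lE : l * (b + h - a) = h by rewrite divfK// gt_eqF.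
have bh0 : 0 <= b + h by lra.
have := @powR_concave R g l a (b + h) g0 g1 l0 l1 a0 bh0.
have := @powR_concave R g l (b + h) a g0 g1 l0 l1 bh0 a0.
have -> : l * (b + h) + (1 - l) * a = a + h by move: lE; lra.
have -> : l * a + (1 - l) * (b + h) = b by move: lE; lra.
lra.
Qed.

(** * Nonnegative definite kernels *)

(** For a real symmetric kernel, the hermitian form at [z] is the sum of the
    real quadratic forms at the real and at the imaginary parts of [z]; the
    cross terms cancel by symmetry. *)
Lemma nonneg_definiteP (R : realType) (F : R -> R -> R) :
  nonneg_definite F <->
  (forall s t, 0 <= s -> 0 <= t -> F s t = F t s) /\
  (forall n (t x : 'I_n -> R), (forall j, 0 <= t j) ->
     0 <= \sum_(j < n) \sum_(k < n) x j * F (t j) (t k) * x k).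
Proof.
split=> -[sF pF]; split=> // n t.
  move=> x t0; have := pF n t (fun j => (x j)%:C%C) t0.
  rewrite -ler0c !rmorph_sum; congr (_ <= _).
  apply: eq_bigr => j _; rewrite rmorph_sum; apply: eq_bigr => k _.
  by rewrite conjc_real !rmorphM.
move=> z t0.
have zE : \sum_(j < n) \sum_(k < n) z j * (F (t j) (t k))%:C%C * ((z k)^*)%C =
   (\sum_(j < n) \sum_(k < n)
     (complex.Re (z j) * F (t j) (t k) * complex.Re (z k) +
      complex.Im (z j) * F (t j) (t k) * complex.Im (z k)))%:C%C +
   'i%C * (\sum_(j < n) \sum_(k < n)
     (complex.Im (z j) * F (t j) (t k) * complex.Re (z k) -
      complex.Re (z j) * F (t j) (t k) * complex.Im (z k)))%:C%C.
  rewrite !rmorph_sum mulr_sumr -big_split; apply: eq_bigr => j _.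
  rewrite !rmorph_sum mulr_sumr -big_split; apply: eq_bigr => k _ /=.
  case: (z j) (z k) => [a b] [c d] /=.
  by simpc; congr (_ +i* _)%C; ring.
rewrite zE.
have -> : \sum_(j < n) \sum_(k < n)
     (complex.Im (z j) * F (t j) (t k) * complex.Re (z k) -
      complex.Re (z j) * F (t j) (t k) * complex.Im (z k)) = 0.
  under eq_bigr do rewrite sumrB.
  rewrite sumrB; apply/eqP; rewrite subr_eq0; apply/eqP.
  rewrite exchange_big; apply: eq_bigr => j _; apply: eq_bigr => k _.
  by rewrite (sF (t k)) //; ring.
rewrite mulr0 addr0 ler0c.
under eq_bigr do rewrite big_split.
by rewrite big_split addr_ge0// pF.
Qed.

Lemma nonneg_definite_lincomb (R : realType) (a b : R) (F G : R -> R -> R) :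
  0 <= a -> 0 <= b -> nonneg_definite F -> nonneg_definite G ->
  nonneg_definite (fun s t => a * F s t + b * G s t).
Proof.
move=> a0 b0 /nonneg_definiteP[sF pF] /nonneg_definiteP[sG pG].
apply/nonneg_definiteP; split=> [s t s0 t0|n t x t0]; first by rewrite sF// sG.
rewrite (_ : \sum_(_ < n) _ =
  a * (\sum_(j < n) \sum_(k < n) x j * F (t j) (t k) * x k) +
  b * (\sum_(j < n) \sum_(k < n) x j * G (t j) (t k) * x k)).
  by rewrite addr_ge0// mulr_ge0 ?pF ?pG.
rewrite !mulr_sumr -big_split; apply: eq_bigr => j _ /=.
rewrite !mulr_sumr -big_split; apply: eq_bigr => k _ /=.
ring.
Qed.

Lemma nonneg_definite_comp (R : realType) (f : R -> R) (F : R -> R -> R) :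
  (forall t, 0 <= t -> 0 <= f t) -> nonneg_definite F ->
  nonneg_definite (fun s t => F (f s) (f t)).
Proof.
move=> f0 [sF pF]; split=> [s t s0 t0|n t z t0]; first by rewrite sF ?f0.
by apply: (pF n (f \o t)) => j; rewrite f0.
Qed.

Lemma eq_nonneg_definite (R : realType) (F G : R -> R -> R) :
  (forall s t, 0 <= s -> 0 <= t -> F s t = G s t) ->
  nonneg_definite G -> nonneg_definite F.
Proof.
move=> FG [sG pG]; split=> [s t s0 t0|n t z t0]; first by rewrite !FG// sG.
by under eq_bigr do under eq_bigr do rewrite FG//; exact: pG.
Qed.

(** The Cauchy-Schwarz inequality for [F], from the form at the vector
    [(F t t, - F s t)]: these weights make the combination of the values at [s]
    and [t] uncorrelated with the value at [t]. *)
Lemma nonneg_definite_cauchy_schwarz (R : realType) (F : R -> R -> R) (s t : R) :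
  nonneg_definite F -> 0 <= s -> 0 <= t -> 0 < F t t ->
  F s t ^+ 2 <= F s s * F t t.
Proof.
move=> /nonneg_definiteP[symF posF] s0 t0 Ft.
have := posF 2%N (fun j => if j == ord0 then s else t)
                 (fun j => if j == ord0 then F t t else - F s t).
rewrite !big_ord_recl !big_ord0 /= !addr0 (symF t s)// => pos.
have /pos : forall j : 'I_2, 0 <= (if j == ord0 then s else t).
  by move=> j; case: ifP.
rewrite -(subr_ge0 (_ ^+ 2)) -(@pmulr_rge0 _ (F t t) (_ - _))//.
by congr (_ <= _); ring.
Qed.

(** * Kernels with nonpositively correlated increments *)

(** Substituting [2 * w i * w j = w i ^+ 2 + w j ^+ 2 - (w i - w j) ^+ 2] turns
    the form into a combination of squares: [w i ^+ 2] is weighted by a row sum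
    and [(w i - w j) ^+ 2] by a negated off-diagonal
    entry. *)
Lemma diag_dominant_form_ge0 (R : realFieldType) (n : nat) (D : 'I_n -> 'I_n -> R)
    (w : 'I_n -> R) :
  (forall i j, D i j = D j i) ->
  (forall i j, i != j -> D i j <= 0) ->
  (forall i, 0 <= \sum_(j < n) D i j) ->
  0 <= \sum_(i < n) \sum_(j < n) D i j * (w i * w j).
Proof.
move=> symD offD rowD.
have rows_ge0 : 0 <= \sum_(i < n) \sum_(j < n) D i j * w i ^+ 2.
  apply: sumr_ge0 => i _; rewrite -mulr_suml.
  by rewrite mulr_ge0// sqr_ge0.
have gaps_le0 : \sum_(i < n) \sum_(j < n) D i j * (w i - w j) ^+ 2 <= 0.
  apply: sumr_le0 => i _; apply: sumr_le0 => j _.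
  have [->|ij] := eqVneq i j; first by rewrite subrr expr0n mulr0.
  by rewrite mulr_le0_ge0 ?sqr_ge0 ?offD.
have colsE : \sum_(i < n) \sum_(j < n) D i j * w j ^+ 2 =
             \sum_(i < n) \sum_(j < n) D i j * w i ^+ 2.
  rewrite exchange_big; apply: eq_bigr => i _; apply: eq_bigr => j _.
  by rewrite symD.
suff : (\sum_(i < n) \sum_(j < n) D i j * (w i * w j)) *+ 2 =
   \sum_(i < n) \sum_(j < n) D i j * w i ^+ 2 +
   \sum_(i < n) \sum_(j < n) D i j * w j ^+ 2 -
   \sum_(i < n) \sum_(j < n) D i j * (w i - w j) ^+ 2.
  by rewrite colsE; lra.
rewrite -sumrMnl -big_split -sumrB; apply: eq_bigr => i _ /=.
rewrite -sumrMnl -big_split -sumrB; apply: eq_bigr => j _ /=.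
ring.
Qed.

(** The indicator is kept inside a sum over a fixed range, so that the
    expansions of [F] at different pairs of points share the same indices and
    the sums can be exchanged. *)
Lemma sum_increments (R : pzRingType) (n a : nat) (f : nat -> R) :
  f 0%N = 0 -> (a <= n)%N ->
  \sum_(i < n) (i < a)%N%:R * (f i.+1 - f i) = f a.
Proof.
move=> f0 an.
under eq_bigr do rewrite mulr_natl mulrb.
rewrite -big_mkcond /= -(big_ord_widen n (fun i => f i.+1 - f i) an).
by rewrite -(big_mkord xpredT (fun i => f i.+1 - f i)) telescope_sumr// f0 subr0.
Qed.

(** Sampling times come in any order and possibly with repetitions, whereas the
    criterion below reads increments along a grid starting at 0.  Repeated
    grid points are harmless: they only produce null increments. *)
Lemma sorted_sample (R : realDomainType) (n : nat) (t : 'I_n -> R) :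
  (forall j, 0 <= t j) ->
  exists (u : nat -> R) (m : 'I_n -> nat),
    [/\ u 0%N = 0,
        forall i j, (i <= j)%N -> (j <= n)%N -> u i <= u j,
        forall j, (m j <= n)%N & forall j, t j = u (m j)].
Proof.
move=> t0.
pose s := sort <=%R [seq t j | j : 'I_n].
have sz : size s = n by rewrite size_sort size_map size_enum_ord.
have mem j : t j \in s by rewrite mem_sort map_f// mem_enum.
exists (nth 0 (0 :: s)), (fun j => (index (t j) s).+1); split => //.
- move=> i j ij jn; apply: le_sorted_leq_nth => //.
  + rewrite /= path_min_sorted ?sort_le_sorted//.
    by apply/allP => x; rewrite mem_sort => /mapP[k _ ->].
  + by rewrite inE /= sz ltnS (leq_trans ij).
  + by rewrite inE /= sz ltnS.
- by move=> j; rewrite -[X in (_ <= X)%N]sz index_mem.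
- by move=> j; rewrite /= nth_index.
Qed.

(** For a covariance [F], this is the covariance of the increment from [a] to [b]
    with the increment from [c] to [d]. *)
Definition rect_increment {R : zmodType} (F : R -> R -> R) (a b c d : R) :=
  (F b d - F a d) - (F b c - F a c).

(** With the process [X] of covariance [F] in mind, [sum_j x j * X (t j)] is
    rewritten as a combination of the increments of [X] along the sorted grid,
    whose covariance matrix is diagonally dominant.  Monotonicity gives the row
    sums, since the increments add up to the last value of [X]. *)
Lemma nonneg_definite_neg_increments (R : realType) (F : R -> R -> R) :
  (forall s t, 0 <= s -> 0 <= t -> F s t = F t s) ->
  (forall t, 0 <= t -> F 0 t = 0) ->
  (forall a b c, 0 <= a -> a <= b -> b <= c -> F a c <= F b c) ->
  (forall a b c d, 0 <= a -> a <= b -> b <= c -> c <= d ->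
     rect_increment F a b c d <= 0) ->
  nonneg_definite F.
Proof.
move=> symF F0 monoF negF; apply/nonneg_definiteP; split=> // n t x t0.
have [u [m [u0 monou mn tE]]] := sorted_sample _ n t t0.
have u_ge0 k : (k <= n)%N -> 0 <= u k by move=> kn; rewrite -u0 monou.
pose D i l := rect_increment F (u i) (u i.+1) (u l) (u l.+1).
have symu k p : (k <= n)%N -> (p <= n)%N -> F (u k) (u p) = F (u p) (u k).
  by move=> kn pn; rewrite symF ?u_ge0.
have F0u k : (k <= n)%N -> F (u 0%N) (u k) = 0.
  by move=> kn; rewrite u0 F0 ?u_ge0.
have Fu0 k : (k <= n)%N -> F (u k) (u 0%N) = 0.
  by move=> kn; rewrite symu ?F0u.
have symD i l : (i < n)%N -> (l < n)%N -> D i l = D l i.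
  move=> iN lN; have [i_n l_n] := (ltnW iN, ltnW lN).
  rewrite /D /rect_increment (symu i l)// (symu i.+1 l)// (symu i l.+1)//.
  by rewrite (symu i.+1 l.+1)//; ring.
have FE a b : (a <= n)%N -> (b <= n)%N ->
  F (u a) (u b) =
  \sum_(i < n) \sum_(l < n) (i < a)%N%:R * (l < b)%N%:R * D i l.
  move=> an bn.
  rewrite -[LHS](sum_increments _ n a (fun i => F (u i) (u b))) ?F0u//.
  apply: eq_bigr => i _.
  under eq_bigr do rewrite -mulrA.
  rewrite -mulr_sumr /D /rect_increment.
  rewrite (sum_increments _ n b (fun l => F (u i.+1) (u l) - F (u i) (u l)))//.
  by rewrite !Fu0 ?subrr// ltnW.
(* The [i]-th increment occurs in [X (t j)] exactly when [i < m j]. *)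
pose w (i : 'I_n) := \sum_(j < n) (i < m j)%N%:R * x j.
have -> : \sum_(j < n) \sum_(k < n) x j * F (t j) (t k) * x k =
          \sum_(i < n) \sum_(l < n) D i l * (w i * w l).
  transitivity (\sum_(j < n) \sum_(k < n) \sum_(i < n) \sum_(l < n)
     D i l * (((i < m j)%N%:R * x j) * ((l < m k)%N%:R * x k))).
    apply: eq_bigr => j _; apply: eq_bigr => k _.
    rewrite !tE FE// mulr_sumr mulr_suml; apply: eq_bigr => i _.
    rewrite mulr_sumr mulr_suml; apply: eq_bigr => l _.
    ring.
  under eq_bigr do rewrite exchange_big.
  rewrite exchange_big; apply: eq_bigr => i _.
  under eq_bigr do rewrite exchange_big.
  rewrite exchange_big; apply: eq_bigr => l _.
  under eq_bigr do rewrite -mulr_sumr -mulr_sumr.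
  by rewrite -mulr_sumr -mulr_suml.
apply: (diag_dominant_form_ge0 R n (fun i l : 'I_n => D i l)).
- by move=> i l; rewrite symD.
- have ltD (i l : 'I_n) : (i < l)%N -> D i l <= 0.
    by move=> il; apply: negF; rewrite ?u_ge0 ?monou// ltnW.
  move=> i l; rewrite neq_ltn => /orP[/ltD//|/ltD].
  by rewrite symD.
- move=> i.
  have := sum_increments _ n n (fun l => F (u i.+1) (u l) - F (u i) (u l)).
  rewrite !Fu0 ?ltn_ord ?(ltnW (ltn_ord i))// subrr => /(_ erefl (leqnn n)).
  under eq_bigr do rewrite ltn_ord mul1r.
  rewrite /D /rect_increment => ->.
  by rewrite subr_ge0 monoF ?u_ge0 ?monou// ltnW.
Qed.

(** * The kernels of the theorem *)

Lemma Ckernel_nonneg_definite (R : realType) (g : R) :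
  0 < g -> g <= 1 -> nonneg_definite (Ckernel g).
Proof.
move=> g0 g1; apply: nonneg_definite_neg_increments; rewrite /Ckernel.
- by move=> s t _ _; rewrite (addrC s) maxC.
- by move=> t t0; rewrite add0r max_r// subrr.
- move=> a b c a0 ab bc; rewrite !max_r ?(le_trans ab)// lerB//.
  by rewrite ge0_ler_powR ?(ltW g0) ?nnegrE//; lra.
- move=> a b c d a0 ab bc cd.
  rewrite /rect_increment !max_r ?(le_trans _ cd) ?(le_trans ab)//.
  have := @powR_increment_nonincreasing R g (a + c) (a + d) (b - a) g0 g1.
  have -> : a + d + (b - a) = b + d by ring.
  have -> : a + c + (b - a) = b + c by ring.
  have h1 : 0 <= a + c by lra.
  have h2 : a + c <= a + d by lra.
  have h3 : 0 <= b - a by lra.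
  by move=> /(_ h1 h2 h3); lra.
Qed.

Lemma Qkernel_nonneg_definite (R : realType) (g : R) :
  0 < g -> g <= 1 -> nonneg_definite (Qkernel g).
Proof.
move=> g0 g1; apply: nonneg_definite_neg_increments; rewrite /Qkernel.
- by move=> s t _ _; rewrite distrC maxC.
- by move=> t t0; rewrite subr0 max_r// ger0_norm// subrr.
- move=> a b c a0 ab bc; rewrite !max_r ?(le_trans ab)// lerB//.
  by rewrite ge0_ler_powR ?(ltW g0) ?nnegrE// !ger0_norm; lra.
- move=> a b c d a0 ab bc cd.
  rewrite /rect_increment !max_r ?(le_trans _ cd) ?(le_trans ab)//.
  rewrite !ger0_norm; try lra.
  have := @powR_increment_nonincreasing R g (c - b) (c - a) (d - c) g0 g1.
  have -> : c - b + (d - c) = d - b by ring.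
  have -> : c - a + (d - c) = d - a by ring.
  have h1 : 0 <= c - b by lra.
  have h2 : c - b <= c - a by lra.
  have h3 : 0 <= d - c by lra.
  by move=> /(_ h1 h2 h3); lra.
Qed.

(** Cauchy-Schwarz at [1 - e] and 1 reads
    [(1 - e `^ g) ^+ 2 <= (1 - e) `^ g <= 1 - e], which fails as soon as
    [2 * e `^ g < e]. *)
Lemma Qkernel_nonneg_definite_le1 (R : realType) (g : R) :
  0 < g -> nonneg_definite (Qkernel g) -> g <= 1.
Proof.
move=> g0 Qpos; rewrite leNgt; apply/negP => g1.
(* This [e] solves [e `^ (g - 1) = 1 / 4]. *)
pose e : R := 4^-1 `^ (g - 1)^-1.
have e0 : 0 < e by rewrite powR_gt0; lra.
have eg : e `^ g = e / 4.
  have -> : g = 1 + (g - 1) by ring.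
  rewrite powRD ?(gt_eqF e0) ?implybT// powRr1 ?ltW//.
  by rewrite -powRrM mulVf ?powRr1; lra.
have e1 : e < 1.
  rewrite -[X in _ < X](congr1 (@^~ (g - 1)^-1) (powR1 R)).
  by rewrite gt0_ltr_powR ?invr_gt0 ?nnegrE; lra.
have s0 : 0 <= 1 - e by lra.
have z0 : 0 `^ g = 0 :> R by rewrite powR0// gt_eqF.
have := nonneg_definite_cauchy_schwarz R (Qkernel g) (1 - e) 1 Qpos s0 ler01.
rewrite /Qkernel !maxxx !subrr normr0 z0 !subr0 powR1 => /(_ ltr01).
have -> : 1 - (1 - e) = e by ring.
rewrite max_r; last by lra.
rewrite powR1 ger0_norm ?(ltW e0) // eg mulr1.
have : (1 - e) `^ g <= 1 - e by rewrite ge1r_powR; lra.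
by move: (sqr_ge0 e); clearbody e; lra.
Qed.

Lemma maxr_powR (R : realType) (r s t : R) : 0 <= r -> 0 <= s -> 0 <= t ->
  Num.max (s `^ r) (t `^ r) = Num.max s t `^ r.
Proof.
move=> r0 s0 t0; case: (leP s t) => st; [rewrite max_r//|rewrite max_l//];
  by rewrite ge0_ler_powR// ltW.
Qed.

(** The powers of the maximum subtracted in [Ckernel] and added in [Qkernel]
    agree, since [t `^ (2 * H)] is monotone and so commutes with [Num.max]. *)
Lemma Rkernel_decomp (R : realType) (H K s t : R) :
  0 < H -> 0 <= s -> 0 <= t ->
  Rkernel H K s t =
    2 `^ (- K) * Ckernel K (s `^ (2 * H)) (t `^ (2 * H))
    + 2 `^ (- K) * Qkernel (2 * H * K) s t.
Proof.
move=> H0 s0 t0; rewrite /Rkernel /Ckernel /Qkernel.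
rewrite maxr_powR//; last by lra.
by rewrite -powRrM powRN (distrC t s); ring.
Qed.

Theorem theorem1p1 (R : realType) :
  (forall g : R, 0 < g -> g <= 1 -> nonneg_definite (Ckernel g)) /\
  (forall g : R, 0 < g -> (nonneg_definite (Qkernel g) <-> g <= 1)) /\
  (forall H K : R, 0 < H -> 0 < K -> K <= 1 -> 2 * H * K <= 1 ->
     nonneg_definite (Rkernel H K) /\
     (forall s t : R, 0 <= s -> 0 <= t ->
        Rkernel H K s t =
          2 `^ (- K) * Ckernel K (s `^ (2 * H)) (t `^ (2 * H))
          + 2 `^ (- K) * Qkernel (2 * H * K) s t)).
Proof.
split; [exact: Ckernel_nonneg_definite | split].
  move=> g g0; split; first exact: Qkernel_nonneg_definite_le1.
  exact: Qkernel_nonneg_definite.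
move=> H K H0 K0 K1 HK1; split; last by move=> s t; exact: Rkernel_decomp.
apply: eq_nonneg_definite (fun s t => Rkernel_decomp R H K s t H0) _.
pose CH (s t : R) := Ckernel K (s `^ (2 * H)) (t `^ (2 * H)).
have CHpos : nonneg_definite CH.
  apply: (nonneg_definite_comp _ (fun t => t `^ (2 * H)) (Ckernel K)).
    by move=> t _; exact: powR_ge0.
  exact: Ckernel_nonneg_definite.
have QHpos : nonneg_definite (Qkernel (2 * H * K)).
  by apply: Qkernel_nonneg_definite => //; rewrite !mulr_gt0.
have k0 : 0 <= 2 `^ (- K) :> R by exact: powR_ge0.
exact: (nonneg_definite_lincomb R _ _ CH (Qkernel (2 * H * K)) k0 k0 CHpos QHpos).
Qed.
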